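(* Let $0\le\lambda<\gamma\le\delta$ and let $\mathfrak{f}=\mathfrak{s}+\overline{\mathfrak{t}}\in\mathcal{R}_H^0(\gamma,\delta,\lambda)$. Let $$ps(r)=(\delta+2\gamma-\lambda)r^2+(-2\delta-4\gamma+2\lambda)r+\delta+\gamma.$$ Then $ps(r)=0$ has a unique real root $r_s$ in $(0,1)$, and $\mathfrak{f}$ is fully starlike in $|z|<r_s$.
   Context: Let $\mathcal{U}=\{z\in\mathbb{C}:|z|<1\}$. $\mathcal{H}^0$ denotes the class of complex-valued harmonic functions $\mathfrak{f}=\mathfrak{s}+\overline{\mathfrak{t}}$ on $\mathcal{U}$, where $\mathfrak{s}(z)=z+\sum_{m\ge2}a_mz^m$ and $\mathfrak{t}(z)=\sum_{m\ge2}b_mz^m$ are analytic in $\mathcal{U}$. For real $0\le\lambda<\gamma\le\delta$, $\mathcal{R}_H^0(\gamma,\delta,\lambda)$ is the class of $\mathfrak{f}=\mathfrak{s}+\overline{\mathfrak{t}}\in\mathcal{H}^0$ such that for all $z\in\mathcal{U}$, $\mathrm{Re}\left[\gamma\mathfrak{s}'(z)+\delta z\mathfrak{s}''(z)+\frac{\delta-\gamma}{2}z^2\mathfrak{s}'''(z)-\lambda\right]>\left|\gamma\mathfrak{t}'(z)+\delta z\mathfrak{t}''(z)+\frac{\delta-\gamma}{2}z^2\mathfrak{t}'''(z)\right|$. A harmonic function $\mathfrak{f}$ with $\mathfrak{f}(0)=0$ is fully starlike in the disk $|z|<R$ if it maps every circle $|z|=\rho$, $0<\rho<R$, in a one-to-one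 manner onto a curve that bounds a domain starlike with respect to the origin. *)

(* Defs.v *)
From Coquelicot Require Import Coquelicot.
From Stdlib Require Import Reals.
Notation C := Complex.C.
Open Scope R_scope.

(* Sum of a complex series, taken componentwise (equals the complex sum
   whenever the series converges). *)
Definition csum (u : nat -> C) : C :=
  (Series (fun n => Re (u n)), Series (fun n => Im (u n))).

Fixpoint ffall (m k : nat) : nat :=
  match k with
  | O => 1%nat
  | S k' => (m * ffall (m - 1) k')%nat
  end.

(* k-th derivative at z of the power series sum_m a_m z^m (termwise) *)
Definition pder (a : nat -> C) (k : nat) (z : C) : C :=
  csum (fun m => (RtoC (INR (ffall m k)) * a m * z ^ (m - k))%C).

Definition analytic_on_U (a : nat -> C) : Prop :=
  forall z : C, Cmod z < 1 -> ex_series (fun m => (a m * z ^ m)%C).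

(* s(z) = z + sum_{m>=2} a_m z^m,  t(z) = sum_{m>=2} b_m z^m *)
Definition in_H0 (a b : nat -> C) : Prop :=
  analytic_on_U a /\ analytic_on_U b /\
  a 0%nat = RtoC 0 /\ a 1%nat = RtoC 1 /\ b 0%nat = RtoC 0 /\ b 1%nat = RtoC 0.

Definition harm (a b : nat -> C) (z : C) : C :=
  (pder a 0 z + Cconj (pder b 0 z))%C.

Definition Lop (g d : R) (a : nat -> C) (z : C) : C :=
  (RtoC g * pder a 1 z + RtoC d * z * pder a 2 z
   + RtoC ((d - g) / 2) * z ^ 2 * pder a 3 z)%C.

Definition in_RH0 (g d l : R) (a b : nat -> C) : Prop :=
  in_H0 a b /\
  forall z : C, Cmod z < 1 ->
    Re (Lop g d a z - RtoC l)%C > Cmod (Lop g d b z).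

Definition circ (rho th : R) : C := (rho * cos th, rho * sin th).

Definition c_open (D : C -> Prop) : Prop :=
  forall x, D x -> exists eps, 0 < eps /\ forall y, Cmod (y - x)%C < eps -> D y.

Definition c_closure (D : C -> Prop) (x : C) : Prop :=
  forall eps, 0 < eps -> exists y, D y /\ Cmod (y - x)%C < eps.

Definition c_boundary (D : C -> Prop) (x : C) : Prop :=
  c_closure D x /\ ~ D x.

Definition c_connected (D : C -> Prop) : Prop :=
  forall U V : C -> Prop, c_open U -> c_open V ->
    (forall x, D x -> U x \/ V x) ->
    (forall x, D x -> U x -> V x -> False) ->
    (exists x, D x /\ U x) -> (exists x, D x /\ V x) -> False.

Definition c_bounded (D : C -> Prop) : Prop :=
  exists M, forall x, D x -> Cmod x <= M.

Definition starlike_domain (D : C -> Prop) : Prop :=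
  c_open D /\ c_connected D /\ D (RtoC 0) /\
  forall w, D w -> forall t, 0 <= t <= 1 -> D (RtoC t * w)%C.

Definition fully_starlike (f : C -> C) (R0 : R) : Prop :=
  forall rho, 0 < rho < R0 ->
    (forall th1 th2, 0 <= th1 < 2 * PI -> 0 <= th2 < 2 * PI ->
       f (circ rho th1) = f (circ rho th2) -> th1 = th2) /\
    exists D : C -> Prop, starlike_domain D /\ c_bounded D /\
      forall w, c_boundary D w <-> exists th, w = f (circ rho th).

Definition ps (g d l r : R) : R :=
  (d + 2 * g - l) * r ^ 2 + (- 2 * d - 4 * g + 2 * l) * r + d + g.

(* Main.v *)
(** On every circle |z| = r < 1 the polynomial truncations of
    Re (Lop a + e Lop b) - l, |e| = 1, are nonnegative up to a small error;
    integrating them against 1 - cos (n x - phi) >= 0 gives Caratheodory's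
    coefficient estimate, and choosing e so that |a_m + e b_m| = |a_m| + |b_m| yields
    m (|a_m| + |b_m|) <= B := 2 (g - l) / (g + d) for m >= 2.  If ps(rho) > 0 then
    q := B rho / (1 - rho) < 1.

    For |z1| = |z2| = rho and s, t >= 0 one has
    |t z1^m - s z2^m| <= m rho^(m-1) |t z1 - s z2|.  Hence f = harm a b satisfies
    |(t f(z1) - s f(z2)) - (t z1 - s z2)| <= q |t z1 - s z2|.
    With s = t this gives injectivity on the circle; with general s and t it shows
    that distinct points of the image curve lie on distinct rays from 0, and that
    the radial gauge t of a point t f(z) is a Lipschitz function of that point.  Every
    ray meets the curve by the intermediate value theorem, so
    { t f(z) : |z| = rho, 0 <= t < 1 } is the required starlike domain. *)

Require Import Defs.
From Coquelicot Require Import Coquelicot.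
From Stdlib Require Import Reals.
From Stdlib Require Import Arith Lra Lia.
Open Scope R_scope.

Local Notation C := Complex.C.

(** * Absolutely summable complex series *)

Definition abs_summable (u : nat -> C) : Prop := ex_series (fun n => Cmod (u n)).

Lemma C_eq (z w : C) : Re z = Re w -> Im z = Im w -> z = w.
Proof. destruct z, w; simpl; intros -> ->; reflexivity. Qed.

Lemma im_le_Cmod (z : C) : Rabs (Im z) <= Cmod z.
Proof.
  apply Rle_trans with (2 := Rmax_Cmod z), Rmax_r.
Qed.

Lemma Cmod_sqr (z : C) : Cmod z * Cmod z = Re z * Re z + Im z * Im z.
Proof. generalize (Cmod2_alt z); nra. Qed.

Lemma Cmod_le_re_im (z : C) : Cmod z <= Rabs (Re z) + Rabs (Im z).
Proof.
  generalize (Cmod_sqr z) (Cmod_ge_0 z) (Rabs_pos (Re z)) (Rabs_pos (Im z))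
    (Rsqr_abs (Re z)) (Rsqr_abs (Im z)); unfold Rsqr; nra.
Qed.

Lemma Cmod_le_of_sqr (z : C) (M : R) :
  0 <= M -> Re z * Re z + Im z * Im z <= M * M -> Cmod z <= M.
Proof. generalize (Cmod_sqr z) (Cmod_ge_0 z); nra. Qed.

Lemma ex_series_dom (u v : nat -> R) :
  (forall n, Rabs (u n) <= v n) -> ex_series v -> ex_series u.
Proof. exact (@ex_series_le R_AbsRing R_CompleteNormedModule u v). Qed.

Lemma abs_summable_dom (u : nat -> C) (v : nat -> R) :
  (forall n, Cmod (u n) <= v n) -> ex_series v -> abs_summable u.
Proof.
  intros H; apply ex_series_dom; intros n.
  rewrite Rabs_pos_eq; [apply H | apply Cmod_ge_0].
Qed.

Lemma abs_summable_re (u : nat -> C) :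
  abs_summable u -> ex_series (fun n => Re (u n)).
Proof. apply ex_series_dom; intros n; apply re_le_Cmod. Qed.

Lemma abs_summable_im (u : nat -> C) :
  abs_summable u -> ex_series (fun n => Im (u n)).
Proof. apply ex_series_dom; intros n; apply im_le_Cmod. Qed.

Lemma abs_summable_plus (u v : nat -> C) :
  abs_summable u -> abs_summable v -> abs_summable (fun n => u n + v n)%C.
Proof.
  intros Hu Hv.
  apply (abs_summable_dom _ (fun n => Cmod (u n) + Cmod (v n))).
  - intros n; apply Cmod_triangle.
  - exact (ex_series_plus _ _ Hu Hv).
Qed.

Lemma abs_summable_scal (c : C) (u : nat -> C) :
  abs_summable u -> abs_summable (fun n => c * u n)%C.
Proof.
  intros Hu.
  apply (abs_summable_dom _ (fun n => Cmod c * Cmod (u n))).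
  - intros n; rewrite Cmod_mult; apply Rle_refl.
  - exact (ex_series_scal_l (Cmod c) _ Hu).
Qed.

Lemma abs_summable_conj (u : nat -> C) :
  abs_summable u -> abs_summable (fun n => Cconj (u n)).
Proof.
  intros Hu; apply (abs_summable_dom _ _ (fun n => Req_le _ _ (Cmod_conj (u n))) Hu).
Qed.

Lemma csum_ext (u v : nat -> C) : (forall n, u n = v n) -> csum u = csum v.
Proof.
  intros H; unfold csum; f_equal; apply Series_ext; intros n; rewrite H; reflexivity.
Qed.

Lemma csum_plus (u v : nat -> C) :
  abs_summable u -> abs_summable v ->
  csum (fun n => u n + v n)%C = (csum u + csum v)%C.
Proof.
  intros Hu Hv; apply C_eq; simpl.
  - rewrite <- Series_plus; auto using abs_summable_re.
  - rewrite <- Series_plus; auto using abs_summable_im.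
Qed.

Lemma csum_scal (c : C) (u : nat -> C) :
  abs_summable u -> csum (fun n => c * u n)%C = (c * csum u)%C.
Proof.
  intros Hu.
  assert (Hr := abs_summable_re _ Hu); assert (Hi := abs_summable_im _ Hu).
  apply C_eq; simpl.
  - rewrite <- !Series_scal_l, <- Series_minus; [reflexivity | |].
    + exact (ex_series_scal_l (fst c) _ Hr).
    + exact (ex_series_scal_l (snd c) _ Hi).
  - rewrite <- !Series_scal_l, <- Series_plus; [reflexivity | |].
    + exact (ex_series_scal_l (fst c) _ Hi).
    + exact (ex_series_scal_l (snd c) _ Hr).
Qed.

Lemma csum_conj (u : nat -> C) : csum (fun n => Cconj (u n)) = Cconj (csum u).
Proof. apply C_eq; simpl; [reflexivity | apply Series_opp]. Qed.

Lemma csum_incr_1 (u : nat -> C) :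
  abs_summable u -> csum u = (u 0%nat + csum (fun n => u (S n)))%C.
Proof.
  intros Hu; apply C_eq; simpl; rewrite Series_incr_1;
    auto using abs_summable_re, abs_summable_im.
Qed.

Lemma abs_summable_incr_1 (u : nat -> C) :
  abs_summable u -> abs_summable (fun n => u (S n)).
Proof. intros Hu; apply (ex_series_incr_1 (fun n => Cmod (u n))), Hu. Qed.

Lemma re_mult_conj_le (z w : C) : Re z * Re w + Im z * Im w <= Cmod z * Cmod w.
Proof.
  generalize (re_le_Cmod (Cconj z * w)); rewrite Cmod_mult, Cmod_conj, re_mult, re_conj.
  intros H; apply Rle_trans with (2 := H), Rle_trans with (2 := Rle_abs _), Req_le.
  destruct z, w; simpl; ring.
Qed.

(** With [w = csum u], the square [|w|^2] is the sum of the real inner products of [w] with the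
    terms, each at most [|w| |u n|] by Cauchy-Schwarz. Dividing by [|w|] gives the claim when [w] is
    not 0. *)
Lemma Cmod_csum_le (u : nat -> C) :
  abs_summable u -> Cmod (csum u) <= Series (fun n => Cmod (u n)).
Proof.
  intros Hu.
  assert (Hr := abs_summable_re _ Hu); assert (Hi := abs_summable_im _ Hu).
  set (w := csum u).
  assert (H : Cmod w * Cmod w <= Cmod w * Series (fun n => Cmod (u n))).
  { assert (Hx : ex_series (fun n => Re w * Re (u n)))
      by exact (ex_series_scal_l (Re w) _ Hr).
    assert (Hy : ex_series (fun n => Im w * Im (u n)))
      by exact (ex_series_scal_l (Im w) _ Hi).
    rewrite Cmod_sqr.
    change (Re w * Series (fun n => Re (u n)) + Im w * Series (fun n => Im (u n))
            <= Cmod w * Series (fun n => Cmod (u n))).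
    rewrite <- !Series_scal_l, <- Series_plus by assumption.
    assert (Hz : ex_series (fun n => Cmod w * Cmod (u n)))
      by exact (ex_series_scal_l (Cmod w) _ Hu).
    apply Rge_le, Rminus_ge, Rle_ge.
    rewrite <- Series_minus;
      [| exact Hz | exact (ex_series_plus _ _ Hx Hy)].
    apply Rle_trans with (Series (fun n : nat => 0 * 0)).
    - rewrite Series_scal_l; lra.
    - apply Series_le.
      + intros n; generalize (re_mult_conj_le w (u n)); split; lra.
      + exact (ex_series_minus _ _ Hz (ex_series_plus _ _ Hx Hy)). }
  destruct (Rle_lt_or_eq_dec 0 (Cmod w) (Cmod_ge_0 w)) as [Hp | H0].
  - apply Rmult_le_reg_l with (1 := Hp), H.
  - rewrite <- H0.
    apply Rle_trans with (Series (fun n : nat => 0 * 0)).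
    + rewrite Series_scal_l; lra.
    + apply Series_le; [intros n; generalize (Cmod_ge_0 (u n)); split; lra | exact Hu].
Qed.

(** * Caratheodory's coefficient estimate *)

Lemma cos_sin_int_period (j : Z) :
  cos (IZR j * (2 * PI)) = 1 /\ sin (IZR j * (2 * PI)) = 0.
Proof.
  assert (H : sin (IZR j * PI) = 0) by (apply sin_eq_0_1; exists j; reflexivity).
  replace (IZR j * (2 * PI)) with (2 * (IZR j * PI)) by ring.
  rewrite cos_2a_sin, sin_2a, H; split; ring.
Qed.

Lemma is_RInt_Rplus (f g : R -> R) (a b If Ig : R) :
  is_RInt f a b If -> is_RInt g a b Ig -> is_RInt (fun x => f x + g x) a b (If + Ig).
Proof. exact (is_RInt_plus f g a b If Ig). Qed.

Lemma is_RInt_Rext (f g : R -> R) (a b If Ig : R) :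
  (forall x, f x = g x) -> If = Ig -> is_RInt f a b If -> is_RInt g a b Ig.
Proof. intros Hfg <-; apply is_RInt_ext; intros x _; apply Hfg. Qed.

(** The frequency is a signed integer because products of modes [k] and [n] produce the difference
    [k - n]. *)
Lemma is_RInt_trig (j : Z) (A B : R) :
  is_RInt (fun x => A * cos (IZR j * x) + B * sin (IZR j * x)) 0 (2 * PI)
    (if Z.eq_dec j 0 then 2 * PI * A else 0).
Proof.
  destruct (Z.eq_dec j 0) as [-> | Hj].
  - apply is_RInt_ext with (fun _ => A).
    + intros x _; rewrite Rmult_0_l, cos_0, sin_0.
      change (A = A * 1 + B * 0); ring.
    + replace (2 * PI * A) with ((2 * PI - 0) * A) by ring.
      exact (is_RInt_const 0 (2 * PI) A).
  - assert (Hj' : IZR j <> 0) by (apply not_0_IZR, Hj).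
    destruct (cos_sin_int_period j) as [Hc Hs].
    set (F := fun x => (A * sin (IZR j * x) - B * cos (IZR j * x)) / IZR j).
    replace 0 with (minus (F (2 * PI)) (F 0)) at 2.
    + apply (is_RInt_derive F).
      * intros x _; unfold F; auto_derive; [exact I | field; exact Hj'].
      * intros x _; apply (ex_derive_continuous (V := R_NormedModule)).
        auto_derive; exact I.
    + unfold F, minus, plus, opp; simpl.
      rewrite Hc, Hs, (Rmult_0_r (IZR j)), cos_0, sin_0; field; exact Hj'.
Qed.

(** Product-to-sum formulas split the integrand into the frequencies [k], [k - n] and [k + n]; over
    a full period only a zero frequency contributes. *)
Lemma is_RInt_trig_kernel (k n : nat) (A B c s : R) :
  (1 <= n)%nat ->
  is_RInt (fun x => (A * cos (INR k * x) + B * sin (INR k * x))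
                    * (1 - (c * cos (INR n * x) + s * sin (INR n * x))))
    0 (2 * PI)
    ((if Nat.eq_dec k 0 then 2 * PI * A else 0)
     - (if Nat.eq_dec k n then PI * (A * c + B * s) else 0)).
Proof.
  intros Hn.
  refine (is_RInt_Rext _ _ _ _ _ _ _ _
    (is_RInt_Rplus _ _ _ _ _ _ (is_RInt_trig (Z.of_nat k) A B)
      (is_RInt_Rplus _ _ _ _ _ _
        (is_RInt_trig (Z.of_nat k - Z.of_nat n)
           (- / 2 * (A * c + B * s)) (- / 2 * (B * c - A * s)))
        (is_RInt_trig (Z.of_nat k + Z.of_nat n)
           (- / 2 * (A * c - B * s)) (- / 2 * (B * c + A * s)))))).
  - intros x; rewrite plus_IZR, minus_IZR, <- !INR_IZR_INZ.
    rewrite !Rmult_plus_distr_r, Rmult_minus_distr_r, cos_plus, cos_minus,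
      sin_plus, sin_minus.
    field.
  - destruct (Z.eq_dec (Z.of_nat k) 0), (Nat.eq_dec k 0), (Nat.eq_dec k n),
      (Z.eq_dec (Z.of_nat k - Z.of_nat n) 0), (Z.eq_dec (Z.of_nat k + Z.of_nat n) 0);
      try lia; field.
Qed.

Lemma is_RInt_trig_sum_kernel (A B : nat -> R) (n K : nat) (c s : R) :
  (1 <= n)%nat ->
  is_RInt (fun x => sum_f_R0 (fun k => A k * cos (INR k * x) + B k * sin (INR k * x)) K
                    * (1 - (c * cos (INR n * x) + s * sin (INR n * x))))
    0 (2 * PI)
    (2 * PI * A 0%nat - (if le_dec n K then PI * (A n * c + B n * s) else 0)).
Proof.
  intros Hn; induction K as [| K IH].
  - generalize (is_RInt_trig_kernel 0 n (A 0%nat) (B 0%nat) c s Hn).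
    destruct (Nat.eq_dec 0 n), (le_dec n 0), (Nat.eq_dec 0 0); try lia; intros H; exact H.
  - refine (is_RInt_Rext _ _ _ _ _ _ _ _ (is_RInt_Rplus _ _ _ _ _ _ IH
              (is_RInt_trig_kernel (S K) n (A (S K)) (B (S K)) c s Hn))).
    + intros x; rewrite tech5; ring.
    + destruct (Nat.eq_dec (S K) 0), (le_dec n K), (le_dec n (S K)), (Nat.eq_dec (S K) n);
        try lia; subst; ring.
Qed.

Lemma trig_poly_coeff_le (A B : nat -> R) (n K : nat) (l c s : R) :
  (1 <= n <= K)%nat -> c * c + s * s = 1 ->
  (forall x, l <= sum_f_R0 (fun k => A k * cos (INR k * x) + B k * sin (INR k * x)) K) ->
  A n * c + B n * s <= 2 * (A 0%nat - l).
Proof.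
  intros [Hn HnK] Hcs Hl.
  (* The constant [- l] enters as a mode of frequency 0, so the integrand is the polynomial minus
     [l], times the kernel. Its integral is [2 PI (A 0 - l) - PI (A n c + B n s)]. *)
  assert (H := is_RInt_Rplus _ _ _ _ _ _
    (is_RInt_trig_sum_kernel A B n K c s Hn)
    (is_RInt_trig_kernel 0 n (- l) 0 c s Hn)).
  destruct (le_dec n K) as [_ | ?]; [| lia].
  destruct (Nat.eq_dec 0 n) as [? | _]; [lia |].
  destruct (Nat.eq_dec 0 0) as [_ | ?]; [| lia].
  apply is_RInt_ge_0 in H.
  - revert H; generalize PI_RGT_0; nra.
  - generalize PI_RGT_0; lra.
  - intros x _.
    rewrite <- Rmult_plus_distr_r; apply Rmult_le_pos.
    + generalize (Hl x); rewrite Rmult_0_l, cos_0; lra.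
    (* The kernel is nonnegative by Lagrange's identity: [(c u + s v)^2 + (c v - s u)^2 = 1]. *)
    + generalize (sin2_cos2 (INR n * x)); unfold Rsqr.
      set (u := cos _); set (v := sin _); intros Huv.
      assert (0 <= (c * v - s * u) * (c * v - s * u)) by apply Rle_0_sqr.
      assert ((c * u + s * v) * (c * u + s * v) <= 1).
      { replace 1 with ((c * c + s * s) * (v * v + u * u)) by (rewrite Hcs, Huv; ring).
        nra. }
      nra.
Qed.

Lemma Series_tail_small (u : nat -> R) (N : nat) (eps : R) :
  ex_series u -> 0 < eps ->
  exists K, (N <= K)%nat /\ Rabs (Series (fun k => u (S K + k)%nat)) < eps.
Proof.
  intros Hu He.
  assert (H := Series_correct _ Hu).
  apply is_series_Reals in H; destruct (H eps He) as [M HM].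
  exists (N + M)%nat; split; [lia |].
  generalize (HM (N + M)%nat ltac:(lia)); unfold Rdist.
  rewrite (Series_incr_n u (S (N + M))) by (lia || assumption); simpl pred.
  intros H1; rewrite <- Rabs_Ropp; eapply Rle_lt_trans with (2 := H1), Req_le.
  f_equal; ring.
Qed.

(** Cutting the series where the absolute tail is below [eps / 2] leaves a trigonometric polynomial
    bounded below by [l - eps / 2]. The polynomial estimate then holds up to [eps], which is
    arbitrary. *)
Lemma caratheodory_coeff (p : nat -> C) (l : R) (n : nat) :
  abs_summable p -> (1 <= n)%nat ->
  (forall x, l <= Re (csum (fun k => p k * (cos (INR k * x), sin (INR k * x)))%C)) ->
  Cmod (p n) <= 2 * (Re (p 0%nat) - l).
Proof.
  intros Hp Hn Hl.
  (* The pair [(c, s)] is the conjugate phase of [p n], which turns the linear form into the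
     modulus; for [p n = 0] any unit vector serves. *)
  assert (Hcs : exists c s, c * c + s * s = 1 /\
            Re (p n) * c + - Im (p n) * s = Cmod (p n)).
  { destruct (Req_dec (Cmod (p n)) 0) as [H0 | H0].
    - exists 1, 0; split; [ring |].
      generalize (Cmod_sqr (p n)); rewrite H0; intros; nra.
    - exists (Re (p n) / Cmod (p n)), (- Im (p n) / Cmod (p n)).
      assert (H := Cmod_sqr (p n)); split.
      + replace (_ + _) with ((Re (p n) * Re (p n) + Im (p n) * Im (p n))
                              / (Cmod (p n) * Cmod (p n))) by (field; exact H0).
        rewrite <- H; field; exact H0.
      + replace (_ + _) with ((Re (p n) * Re (p n) + Im (p n) * Im (p n))
                              / Cmod (p n)) by (field; exact H0).
        rewrite <- H; field; exact H0. }
  destruct Hcs as (c & s & Hcs & <-).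
  apply le_epsilon; intros eps He.
  destruct (Series_tail_small _ n (eps / 2) Hp) as (K & HnK & HK); [lra |].
  set (T := fun x k => Re (p k) * cos (INR k * x) + - Im (p k) * sin (INR k * x)).
  assert (HT : forall x k, Rabs (T x k) <= Cmod (p k)).
  { intros x k; unfold T.
    replace (_ + _) with (Re (p k * (cos (INR k * x), sin (INR k * x)))%C)
      by (rewrite re_mult; simpl; ring).
    eapply Rle_trans; [apply re_le_Cmod |].
    rewrite Cmod_mult.
    enough (Cmod (cos (INR k * x), sin (INR k * x)) <= 1)
      by (generalize (Cmod_ge_0 (p k)); nra).
    apply Cmod_le_of_sqr; [lra |]; simpl.
    generalize (sin2_cos2 (INR k * x)); unfold Rsqr; lra. }
  enough (Re (p n) * c + - Im (p n) * s <= 2 * (Re (p 0%nat) - (l - eps / 2))) by lra.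
  apply (trig_poly_coeff_le (fun k => Re (p k)) (fun k => - Im (p k)) n K);
    [lia | exact Hcs |].
  intros x; fold (T x).
  assert (HTs : ex_series (T x)) by (apply ex_series_dom with (2 := Hp), HT).
  assert (Hx := Hl x); unfold csum in Hx; simpl Re in Hx.
  rewrite (Series_ext _ (T x)) in Hx
    by (intros k; unfold T, Re, Im; simpl; ring).
  rewrite (Series_incr_n _ (S K)) in Hx by (lia || assumption).
  simpl pred in Hx.
  assert (Hpt : ex_series (fun k => Cmod (p (S K + k)%nat)))
    by apply (ex_series_incr_n (fun k => Cmod (p k))), Hp.
  assert (Htail : Series (fun k => T x (S K + k)%nat)
                  <= Series (fun k => Cmod (p (S K + k)%nat))).
  { eapply Rle_trans; [apply Rle_abs |].
    assert (Ha : ex_series (fun k => Rabs (T x (S K + k)%nat))).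
    { apply ex_series_dom with (2 := Hpt); intros k; rewrite Rabs_Rabsolu; apply HT. }
    eapply Rle_trans; [apply Series_Rabs, Ha |].
    apply Series_le; [| exact Hpt].
    intros k; split; [apply Rabs_pos | apply HT]. }
  apply Rabs_def2 in HK.
  lra.
Qed.

(** * Starlike images of circles *)

Definition star_shaped (D : C -> Prop) : Prop :=
  forall w, D w -> forall t, 0 <= t <= 1 -> D (RtoC t * w)%C.

Lemma Cmod_circ (rho th : R) : 0 <= rho -> Cmod (circ rho th) = rho.
Proof.
  intros Hr.
  assert (H := Cmod_sqr (circ rho th)); simpl in H.
  generalize (sin2_cos2 th) (Cmod_ge_0 (circ rho th)); unfold Rsqr; intros H1 H2.
  nra.
Qed.

(** Let [m] be the supremum of the parameters whose point lies in [U]. If the point at [m] is in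
    [U], openness pushes past [m] or [m = 1] meets [V]; if it is in [V], openness gives a smaller
    upper bound. *)
Lemma segment_connected (U V : C -> Prop) (w : C) :
  c_open U -> c_open V ->
  (forall t, 0 <= t <= 1 -> U (RtoC t * w)%C \/ V (RtoC t * w)%C) ->
  (forall t, 0 <= t <= 1 -> U (RtoC t * w)%C -> V (RtoC t * w)%C -> False) ->
  U (RtoC 0 * w)%C -> V (RtoC 1 * w)%C -> False.
Proof.
  intros HU HV Hcov Hdis H0 H1.
  set (E := fun t => 0 <= t <= 1 /\ U (RtoC t * w)%C).
  destruct (completeness E) as [m [Hub Hlub]].
  { exists 1; intros t [Ht _]; lra. }
  { exists 0; split; [lra | exact H0]. }
  assert (Hm0 : 0 <= m) by (apply Hub; split; [lra | exact H0]).
  assert (Hm1 : m <= 1) by (apply Hlub; intros t [Ht _]; lra).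
  assert (Hdist : forall t t', Cmod (RtoC t * w - RtoC t' * w)%C = Rabs (t - t') * Cmod w).
  { intros t t'; rewrite <- Cmod_R, <- Cmod_mult; f_equal.
    rewrite RtoC_minus; ring. }
  assert (Hw := Cmod_ge_0 w).
  assert (Hsmall : forall eps, 0 < eps -> exists d, 0 < d /\
            forall t, Rabs (t - m) <= d -> Cmod (RtoC t * w - RtoC m * w)%C < eps).
  (* The [+ 1] keeps the divisor positive when [w] is 0. *)
  { intros eps He; exists (eps / (Cmod w + 1)).
    assert (Hd : 0 < eps / (Cmod w + 1)) by (apply Rdiv_lt_0_compat; lra).
    split; [exact Hd |]; intros t Ht; rewrite Hdist.
    apply Rle_lt_trans with (eps / (Cmod w + 1) * Cmod w).
    - apply Rmult_le_compat_r; assumption.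
    - apply Rlt_le_trans with (eps / (Cmod w + 1) * (Cmod w + 1)); [nra |].
      apply Req_le; field; lra. }
  destruct (Hcov m) as [Hm | Hm]; [lra | |].
  - destruct (HU _ Hm) as (eps & He & HeU), (Hsmall eps He) as (d & Hd & Hdm).
    destruct (Rle_lt_or_eq_dec m 1 Hm1) as [Hlt | ->].
    + assert (Ht : m < Rmin 1 (m + d)) by (apply Rmin_glb_lt; lra).
      assert (HE : E (Rmin 1 (m + d))).
      { generalize (Rmin_l 1 (m + d)) (Rmin_r 1 (m + d)); intros; split; [lra |].
        apply HeU, Hdm, Rabs_le; lra. }
      generalize (Hub _ HE); lra.
    + apply (Hdis 1); [lra | exact Hm | exact H1].
  - destruct (HV _ Hm) as (eps & He & HeV), (Hsmall eps He) as (d & Hd & Hdm).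
    assert (Hub' : is_upper_bound E (m - d)).
    { intros t [Ht HUt]; apply Rnot_lt_le; intros Hlt.
      apply (Hdis t Ht HUt), HeV, Hdm, Rabs_le.
      split; [lra |].
      generalize (Hub t (conj Ht HUt)); lra. }
    generalize (Hlub _ Hub'); lra.
Qed.

Lemma star_shaped_connected (D : C -> Prop) : star_shaped D -> c_connected D.
Proof.
  intros HD.
  (* By symmetry of [U] and [V] the origin may be placed in [U]; the segment from it to a point of
     [D] in [V] then gives the contradiction. *)
  enough (H : forall U V : C -> Prop, c_open U -> c_open V ->
    (forall x, D x -> U x \/ V x) -> (forall x, D x -> U x -> V x -> False) ->
    forall x y, D x -> U x -> D y -> V y -> U (RtoC 0) -> False).
  { intros U V HU HV Hcov Hdis (x & HDx & Hx) (y & HDy & Hy).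
    assert (HD0 : D (RtoC 0)).
    { replace (RtoC 0) with (RtoC 0 * x)%C by ring; apply HD; [exact HDx | lra]. }
    destruct (Hcov _ HD0) as [H0 | H0].
    - exact (H U V HU HV Hcov Hdis x y HDx Hx HDy Hy H0).
    - apply (H V U HV HU) with (x := y) (y := x); auto.
      + intros z Hz; destruct (Hcov z Hz); auto.
      + intros z Hz HVz HUz; exact (Hdis z Hz HUz HVz). }
  intros U V HU HV Hcov Hdis x y _ _ HDy Hy H0.
  apply (segment_connected U V y HU HV).
  - intros t Ht; apply Hcov, HD; assumption.
  - intros t Ht; apply Hdis, HD; assumption.
  - replace (RtoC 0 * y)%C with (RtoC 0) by ring; exact H0.
  - replace (RtoC 1 * y)%C with y by ring; exact Hy.
Qed.

Lemma polar_form (w : C) : exists th, w = circ (Cmod w) th.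
Proof.
  destruct (Req_dec (Cmod w) 0) as [H0 | H0].
  - exists 0; rewrite (Cmod_eq_0 _ H0), Cmod_0; apply C_eq; simpl; ring.
  - assert (Hp : 0 < Cmod w) by (generalize (Cmod_ge_0 w); lra).
    set (x := Re w / Cmod w); set (y := Im w / Cmod w).
    assert (Hx : Re w = Cmod w * x) by (unfold x; field; exact H0).
    assert (Hy : Im w = Cmod w * y) by (unfold y; field; exact H0).
    assert (Hxy : x * x + y * y = 1).
    { apply Rmult_eq_reg_l with (Cmod w * Cmod w); [| nra].
      generalize (Cmod_sqr w); rewrite Hx, Hy; lra. }
    assert (Hx1 : -1 <= x <= 1) by nra.
    destruct (Rle_lt_dec 0 y) as [Hy0 | Hy0].
    + exists (acos x); apply C_eq; simpl.
      * rewrite cos_acos by exact Hx1; exact Hx.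
      * rewrite sin_acos by exact Hx1; rewrite Hy; f_equal.
        symmetry; apply sqrt_lem_1; unfold Rsqr; nra.
    + exists (- acos x); apply C_eq; simpl.
      * rewrite cos_neg, cos_acos by exact Hx1; exact Hx.
      * rewrite sin_neg, sin_acos by exact Hx1; rewrite Hy; f_equal.
        enough (sqrt (1 - Rsqr x) = - y) by lra.
        apply sqrt_lem_1; unfold Rsqr; nra.
Qed.

(** Equal points force [cos (th1 - th2) = 1], so half the difference is an integer multiple of [PI];
    the range of the angles bounds it strictly between [- PI] and [PI]. *)
Lemma circ_inj (rho th1 th2 : R) :
  0 < rho -> 0 <= th1 < 2 * PI -> 0 <= th2 < 2 * PI ->
  circ rho th1 = circ rho th2 -> th1 = th2.
Proof.
  intros Hr H1 H2 H.
  assert (Hc : cos th1 = cos th2)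
    by (apply Rmult_eq_reg_l with rho; [exact (f_equal fst H) | lra]).
  assert (Hs : sin th1 = sin th2)
    by (apply Rmult_eq_reg_l with rho; [exact (f_equal snd H) | lra]).
  assert (Hd : cos (th1 - th2) = 1).
  { rewrite cos_minus, Hc, Hs; generalize (sin2_cos2 th2); unfold Rsqr; lra. }
  assert (Hh : sin ((th1 - th2) / 2) = 0).
  { replace (th1 - th2) with (2 * ((th1 - th2) / 2)) in Hd by field.
    rewrite cos_2a_sin in Hd; nra. }
  destruct (sin_eq_0_0 _ Hh) as [k Hk].
  assert (HP := PI_RGT_0).
  assert (Hk1 : (-1 < k)%Z) by (apply lt_IZR; simpl; nra).
  assert (Hk2 : (k < 1)%Z) by (apply lt_IZR; simpl; nra).
  assert (k = 0%Z) as -> by lia.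
  simpl in Hk; lra.
Qed.

(** The squared chord is [rho^2 (2 - 2 cos (th1 - th2))], that is [4 rho^2 sin^2] of the half angle,
    and [|sin x| <= |x|]. *)
Lemma circ_dist_le (rho th1 th2 : R) :
  0 <= rho -> Cmod (circ rho th1 - circ rho th2)%C <= rho * Rabs (th1 - th2).
Proof.
  intros Hr.
  apply Cmod_le_of_sqr.
  { apply Rmult_le_pos; [exact Hr | apply Rabs_pos]. }
  assert (Hsin : forall x, Rabs (sin x) <= Rabs x).
  { assert (Hpos : forall x, 0 <= x -> Rabs (sin x) <= x).
    { intros x [Hx | <-]; [| rewrite sin_0, Rabs_R0; lra].
      apply Rabs_le; split.
      - destruct (Rle_lt_dec x PI).
        + generalize (sin_ge_0 x ltac:(lra) ltac:(lra)); lra.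
        + generalize (SIN_bound x) PI2_1 ; lra.
      - apply Rlt_le, sin_lt_x, Hx. }
    intros x; destruct (Rle_lt_dec 0 x) as [Hx | Hx].
    - rewrite (Rabs_pos_eq x Hx); apply Hpos, Hx.
    - rewrite <- Rabs_Ropp, <- sin_neg, <- (Rabs_Ropp x), (Rabs_pos_eq (- x)) by lra.
      apply Hpos; lra. }
  set (x := (th1 - th2) / 2).
  assert (Hx : th1 - th2 = 2 * x) by (unfold x; field).
  assert (H := Rsqr_le_abs_1 _ _ (Hsin x)); unfold Rsqr in H.
  replace (rho * Rabs (th1 - th2) * (rho * Rabs (th1 - th2)))
    with (rho * rho * ((th1 - th2) * (th1 - th2)))
    by (rewrite (Rsqr_abs (th1 - th2) : _ * _ = _ * _); ring).
  replace (Re (circ rho th1 - circ rho th2)%C * Re (circ rho th1 - circ rho th2)%C +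
           Im (circ rho th1 - circ rho th2)%C * Im (circ rho th1 - circ rho th2)%C)
    with (rho * rho * (2 - 2 * cos (th1 - th2))).
  - rewrite Hx, cos_2a_sin.
    assert (0 <= rho * rho) by nra.
    apply Rmult_le_compat_l; [assumption | lra].
  - rewrite cos_minus; simpl.
    generalize (sin2_cos2 th1) (sin2_cos2 th2); unfold Rsqr; intros E1 E2.
    replace (2 - _) with ((sin th1 * sin th1 + cos th1 * cos th1)
       + (sin th2 * sin th2 + cos th2 * cos th2)
       - 2 * (cos th1 * cos th2 + sin th1 * sin th2)) by (rewrite E1, E2; ring).
    ring.
Qed.

Lemma Cmod_reverse_triangle (z w : C) : Rabs (Cmod z - Cmod w) <= Cmod (z - w)%C.
Proof.
  assert (H1 := Cmod_triangle (z - w)%C w).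
  assert (H2 := Cmod_triangle (w - z)%C z).
  replace (z - w + w)%C with z in H1 by ring.
  replace (w - z + z)%C with w in H2 by ring.
  replace (w - z)%C with (- (z - w))%C in H2 by ring.
  rewrite Cmod_opp in H2.
  apply Rabs_le; lra.
Qed.

(** * Maps that are close to the identity on a circle, at all pairs of radial scalings *)

Section StarlikeImage.

Variables (f : C -> C) (rho q : R).
Hypothesis rho_pos : 0 < rho.
Hypothesis q_range : 0 <= q < 1.
Hypothesis f_near_id : forall s t th1 th2, 0 <= s -> 0 <= t ->
  Cmod ((RtoC t * f (circ rho th1) - RtoC s * f (circ rho th2))
        - (RtoC t * circ rho th1 - RtoC s * circ rho th2))%C
  <= q * Cmod (RtoC t * circ rho th1 - RtoC s * circ rho th2)%C.

Lemma image_dist_ge (s t th1 th2 : R) :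
  0 <= s -> 0 <= t ->
  (1 - q) * Cmod (RtoC t * circ rho th1 - RtoC s * circ rho th2)%C
  <= Cmod (RtoC t * f (circ rho th1) - RtoC s * f (circ rho th2))%C.
Proof.
  intros Hs Ht.
  assert (H := f_near_id s t th1 th2 Hs Ht).
  set (u := (RtoC t * f (circ rho th1) - RtoC s * f (circ rho th2))%C) in *.
  set (v := (RtoC t * circ rho th1 - RtoC s * circ rho th2)%C) in *.
  generalize (Cmod_reverse_triangle u v); intros H1; apply Rabs_le_between in H1.
  lra.
Qed.

(** Since both circle points have modulus [rho], [|t z1 - s z2| >= rho |t - s|] whatever the angles.
    This controls the gauge by the distance and drives the openness and boundary arguments for the
    domain. *)
Lemma image_gauge_gap (s t th1 th2 : R) :
  0 <= s -> 0 <= t ->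
  (1 - q) * rho * Rabs (t - s)
  <= Cmod (RtoC t * f (circ rho th1) - RtoC s * f (circ rho th2))%C.
Proof.
  intros Hs Ht.
  eapply Rle_trans; [| apply image_dist_ge; assumption].
  rewrite Rmult_assoc; apply Rmult_le_compat_l; [lra |].
  eapply Rle_trans; [| apply Cmod_reverse_triangle].
  rewrite !Cmod_mult, !Cmod_R, !Cmod_circ, !Rabs_pos_eq with (x := t),
    !Rabs_pos_eq with (x := s) by lra.
  replace (t * rho - s * rho) with (rho * (t - s)) by ring.
  rewrite Rabs_mult, (Rabs_pos_eq rho) by lra; lra.
Qed.

Lemma image_displacement_le (th : R) :
  Cmod (f (circ rho th) - circ rho th)%C <= q * rho.
Proof.
  assert (H := f_near_id 0 1 th th ltac:(lra) ltac:(lra)).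
  replace (RtoC 1 * f (circ rho th) - RtoC 0 * f (circ rho th)
           - (RtoC 1 * circ rho th - RtoC 0 * circ rho th))%C
    with (f (circ rho th) - circ rho th)%C in H by ring.
  replace (RtoC 1 * circ rho th - RtoC 0 * circ rho th)%C with (circ rho th) in H by ring.
  rewrite Cmod_circ in H by lra; exact H.
Qed.

(** The factor 2 bounds [1 + q]. The estimate supplies the continuity needed for the intermediate
    value theorem. *)
Lemma image_lipschitz (th1 th2 : R) :
  Cmod (f (circ rho th1) - f (circ rho th2))%C <= 2 * rho * Rabs (th1 - th2).
Proof.
  assert (H := f_near_id 1 1 th1 th2 ltac:(lra) ltac:(lra)).
  assert (Hc := circ_dist_le rho th1 th2 ltac:(lra)).
  replace (RtoC 1 * f (circ rho th1) - RtoC 1 * f (circ rho th2)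
           - (RtoC 1 * circ rho th1 - RtoC 1 * circ rho th2))%C
    with ((f (circ rho th1) - f (circ rho th2)) - (circ rho th1 - circ rho th2))%C
    in H by ring.
  replace (RtoC 1 * circ rho th1 - RtoC 1 * circ rho th2)%C
    with (circ rho th1 - circ rho th2)%C in H by ring.
  set (u := (f (circ rho th1) - f (circ rho th2))%C) in *.
  set (v := (circ rho th1 - circ rho th2)%C) in *.
  generalize (Cmod_reverse_triangle u v) (Cmod_ge_0 v); intros H1 H2;
    apply Rabs_le_between in H1.
  nra.
Qed.

Lemma image_injective (th1 th2 : R) :
  0 <= th1 < 2 * PI -> 0 <= th2 < 2 * PI ->
  f (circ rho th1) = f (circ rho th2) -> th1 = th2.
Proof.
  intros H1 H2 Hf; apply (circ_inj rho); try assumption.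
  assert (H := image_dist_ge 1 1 th1 th2 ltac:(lra) ltac:(lra)).
  rewrite Hf in H.
  replace (RtoC 1 * f (circ rho th2) - RtoC 1 * f (circ rho th2))%C
    with (RtoC 0) in H by ring.
  rewrite Cmod_0 in H.
  set (v := (RtoC 1 * circ rho th1 - RtoC 1 * circ rho th2)%C) in *.
  assert (Hv : v = RtoC 0) by (apply Cmod_eq_0; generalize (Cmod_ge_0 v); nra).
  replace (circ rho th1) with (v + circ rho th2)%C by (unfold v; ring).
  rewrite Hv; ring.
Qed.

(** [G] is the component of the image orthogonal to direction [phi]. At [phi + PI / 2] and
    [phi - PI / 2] the circle contributes [rho] and [- rho] to it, and the displacement of at most
    [q * rho] cannot undo these signs, so [G] vanishes in between. *)
Lemma image_meets_ray (phi : R) :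
  exists th P, 0 < P /\ f (circ rho th) = circ P phi.
Proof.
  set (G := fun th => cos phi * Im (f (circ rho th)) - sin phi * Re (f (circ rho th))).
  assert (Hcs := sin2_cos2 phi); unfold Rsqr in Hcs.
  (* The orthogonal component is the imaginary part after rotation by [- phi]. *)
  assert (Hproj : forall u : C, Rabs (cos phi * Im u - sin phi * Re u) <= Cmod u).
  { intros u; generalize (im_le_Cmod (u * (cos phi, (- sin phi)%R))%C).
    rewrite Cmod_mult, im_mult; simpl Re; simpl Im.
    replace (Cmod (cos phi, (- sin phi)%R)) with 1.
    - intros H; eapply Rle_trans with (2 := Rle_trans _ _ _ H (Req_le _ _ (Rmult_1_r _))).
      apply Req_le; f_equal; ring.
    - symmetry; rewrite <- (Cmod_circ 1 phi), <- Cmod_conj by lra.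
      f_equal; apply C_eq; simpl; ring. }
  assert (HGdist : forall th1 th2, Rabs (G th1 - G th2) <= 2 * rho * Rabs (th1 - th2)).
  { intros th1 th2; eapply Rle_trans with (2 := image_lipschitz th1 th2).
    eapply Rle_trans with (2 := Hproj _); apply Req_le; f_equal.
    unfold G, Re, Im; simpl; ring. }
  assert (HGc : continuity G).
  { intros x eps He; exists (eps / (2 * rho)); split.
    - apply Rdiv_lt_0_compat; lra.
    - intros y [_ Hy]; simpl in *; unfold Rdist in *.
      eapply Rle_lt_trans; [apply HGdist |].
      apply Rmult_lt_reg_r with (/ (2 * rho)); [apply Rinv_0_lt_compat; lra |].
      replace (2 * rho * Rabs (y - x) * / (2 * rho)) with (Rabs (y - x)) by (field; lra).
      exact Hy. }
  assert (HGz : forall th, Rabs (G th - rho * sin (th - phi)) <= q * rho).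
  { intros th; eapply Rle_trans with (2 := image_displacement_le th).
    eapply Rle_trans with (2 := Hproj _); apply Req_le; f_equal.
    unfold G, Re, Im; rewrite sin_minus; simpl; ring. }
  assert (Hp := HGz (phi + PI / 2)); assert (Hm := HGz (phi - PI / 2)).
  replace (phi + PI / 2 - phi) with (PI / 2) in Hp by ring.
  replace (phi - PI / 2 - phi) with (- (PI / 2)) in Hm by ring.
  rewrite sin_neg in Hm; rewrite sin_PI2 in Hp, Hm.
  apply Rabs_le_between in Hp; apply Rabs_le_between in Hm.
  assert (HP := PI_RGT_0).
  destruct (IVT_gen G (phi - PI / 2) (phi + PI / 2) 0) as (th & Hth & HG0).
  { exact HGc. }
  { rewrite Rmin_left, Rmax_right by nra; nra. }
  rewrite Rmin_left, Rmax_right in Hth by lra.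
  exists th.
  set (P := cos phi * Re (f (circ rho th)) + sin phi * Im (f (circ rho th))).
  exists P.
  assert (Hf : f (circ rho th) = circ P phi).
  { assert (Hrot : forall x y c s, s * s + c * c = 1 -> c * y - s * x = 0 ->
              x = (c * x + s * y) * c /\ y = (c * x + s * y) * s).
    { intros x y c s H1 H2; split.
      - replace ((c * x + s * y) * c) with ((s * s + c * c) * x + s * (c * y - s * x)) by ring.
        rewrite H1, H2; ring.
      - replace ((c * x + s * y) * s) with ((s * s + c * c) * y - c * (c * y - s * x)) by ring.
        rewrite H1, H2; ring. }
    destruct (Hrot _ _ _ _ Hcs HG0); apply C_eq; assumption. }
  split; [| exact Hf].
  clear HG0; clearbody P.
  (* The zero lies within [PI / 2] of [phi], so [cos (th - phi) >= 0]. With [P <= 0] the law of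
     cosines would put the image at distance at least [rho] from its circle point, against the bound
     [q * rho]. *)
  apply Rnot_le_lt; intros HP0.
  assert (H := image_displacement_le th); rewrite Hf in H.
  assert (Hcos : 0 <= cos (th - phi)) by (apply cos_ge_0; lra).
  assert (H2 := Cmod_sqr (circ P phi - circ rho th)%C).
  assert (H3 : Re (circ P phi - circ rho th)%C * Re (circ P phi - circ rho th)%C
    + Im (circ P phi - circ rho th)%C * Im (circ P phi - circ rho th)%C
    = P * P + rho * rho - 2 * P * rho * cos (th - phi)).
  { rewrite cos_minus; simpl.
    generalize (sin2_cos2 th); unfold Rsqr; intros Hcs'.
    replace (P * P) with (P * P * (sin phi * sin phi + cos phi * cos phi))
      by (rewrite Hcs; ring).
    replace (rho * rho) with (rho * rho * (sin th * sin th + cos th * cos th))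
      by (rewrite Hcs'; ring).
    ring. }
  rewrite H3 in H2.
  assert (0 <= - P * rho) by nra.
  assert (0 <= - P * rho * cos (th - phi)) by (apply Rmult_le_pos; assumption).
  assert (Hc := Cmod_ge_0 (circ P phi - circ rho th)%C).
  assert (Cmod (circ P phi - circ rho th)%C < rho) by nra.
  nra.
Qed.

(** The curve point on the ray of [w] is rescaled by [|w| / P]. Having such coordinates on the whole
    plane reduces membership questions to comparing gauges with 1. *)
Lemma image_polar_coords (w : C) :
  exists t th, 0 <= t /\ w = (RtoC t * f (circ rho th))%C.
Proof.
  destruct (polar_form w) as [phi Hphi].
  destruct (image_meets_ray phi) as (th & P & HP & Hf).
  exists (Cmod w / P), th; split.
  - apply Rdiv_le_0_compat; [apply Cmod_ge_0 | exact HP].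
  - rewrite Hf, Hphi at 1; apply C_eq; simpl; field; lra.
Qed.

Lemma starlike_image :
  exists D : C -> Prop, starlike_domain D /\ c_bounded D /\
    forall w, c_boundary D w <-> exists th, w = f (circ rho th).
Proof.
  exists (fun w => exists t th, 0 <= t < 1 /\ w = (RtoC t * f (circ rho th))%C).
  set (D := fun w => _).
  assert (Hgap : 0 < (1 - q) * rho) by nra.
  assert (Hone : forall th, f (circ rho th) = (RtoC 1 * f (circ rho th))%C)
    by (intros th; ring).
  assert (Hstar : star_shaped D).
  { intros w (t & th & Ht & ->) u Hu; exists (u * t), th; split; [nra |].
    rewrite RtoC_mult; ring. }
  split; [split; [| split; [| split]] | split].
  - intros w (t & th & Ht & ->).
    (* Within this radius the gauge changes by less than [1 - t], hence stays below 1. *)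
    exists ((1 - q) * rho * (1 - t)); split; [nra |].
    intros y Hy.
    destruct (image_polar_coords y) as (s & th' & Hs & ->).
    exists s, th'; split; [| reflexivity].
    split; [exact Hs |].
    assert (H := image_gauge_gap t s th' th ltac:(lra) Hs).
    generalize (Rle_abs (s - t)); nra.
  - apply star_shaped_connected, Hstar.
  - exists 0, 0; split; [lra | ring].
  - exact Hstar.
  - exists ((1 + q) * rho); intros w (t & th & Ht & ->).
    rewrite Cmod_mult, Cmod_R, Rabs_pos_eq by lra.
    assert (H1 := image_displacement_le th).
    assert (H2 := Cmod_reverse_triangle (f (circ rho th)) (circ rho th)).
    rewrite (Cmod_circ rho th) in H2 by lra.
    apply Rabs_le_between in H2.
    generalize (Cmod_ge_0 (f (circ rho th))); nra.
  - intros w; split.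
    + intros [Hcl HnD].
      destruct (image_polar_coords w) as (t & th & Ht & ->).
      destruct (Rtotal_order t 1) as [H1 | [-> | H1]].
      * exfalso; apply HnD; exists t, th; split; [lra | reflexivity].
      * exists th; symmetry; apply Hone.
      * exfalso.
        (* A point of gauge [t > 1] is farther than this from every point of gauge below 1, so it is
           not in the closure. *)
        destruct (Hcl ((1 - q) * rho * (t - 1))) as (y & (s & th' & Hs & ->) & Hy);
          [nra |].
        assert (H := image_gauge_gap t s th' th Ht ltac:(lra)).
        rewrite Rabs_minus_sym in H.
        generalize (Rle_abs (t - s)); nra.
    + intros [th ->]; split.
      * intros eps He.
        set (M := Cmod (f (circ rho th))).
        assert (HM : 0 <= M) by apply Cmod_ge_0.
        (* Shrinking the curve point by the factor [1 - d] moves it by [d * M], which is below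
           [eps]; the cap at 1 keeps [1 - d] nonnegative. *)
        set (d := Rmin 1 (eps / (2 * (M + 1)))).
        assert (Hd : 0 < d <= 1).
        { split; [| apply Rmin_l].
          apply Rmin_glb_lt; [lra | apply Rdiv_lt_0_compat; lra]. }
        assert (Hd2 : d * (M + 1) <= eps / 2).
        { apply Rle_trans with (eps / (2 * (M + 1)) * (M + 1)).
          - apply Rmult_le_compat_r; [lra | apply Rmin_r].
          - apply Req_le; field; lra. }
        exists (RtoC (1 - d) * f (circ rho th))%C; split.
        -- exists (1 - d), th; split; [lra | reflexivity].
        -- replace (RtoC (1 - d) * f (circ rho th) - f (circ rho th))%C
             with (RtoC (- d) * f (circ rho th))%C
             by (rewrite RtoC_minus, RtoC_opp; ring).
           rewrite Cmod_mult, Cmod_R, Rabs_Ropp, Rabs_pos_eq by lra.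
           fold M; nra.
      * intros (t & th' & Ht & Hw).
        (* One point would have both gauges 1 and [t < 1], which the gap estimate forbids. *)
        assert (H := image_gauge_gap t 1 th th' ltac:(lra) ltac:(lra)).
        rewrite <- Hone, Hw in H.
        replace (RtoC t * f (circ rho th') - RtoC t * f (circ rho th'))%C
          with (RtoC 0) in H by ring.
        rewrite Cmod_0 in H.
        generalize (Rle_abs (1 - t)); nra.
Qed.

End StarlikeImage.

(** * Harmonic series *)

Lemma ex_series_Rext (u v : nat -> R) :
  (forall n, u n = v n) -> ex_series u -> ex_series v.
Proof. exact (ex_series_ext u v). Qed.

Lemma sum_n_C (u : nat -> C) (n : nat) :
  sum_n u n = (sum_n (fun k => Re (u k)) n, sum_n (fun k => Im (u k)) n).
Proof.
  induction n as [| n IH].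
  - rewrite !sum_O; destruct (u 0%nat); reflexivity.
  - rewrite !sum_Sn, IH; reflexivity.
Qed.

Lemma ex_series_C_components (u : nat -> C) :
  ex_series u -> ex_series (fun n => Re (u n)) /\ ex_series (fun n => Im (u n)).
Proof.
  intros [s Hs]; split.
  - exists (Re s).
    apply (filterlim_ext (fun n => Re (sum_n u n))).
    { intros n; rewrite sum_n_C; reflexivity. }
    apply filterlim_comp with (1 := Hs).
    intros P [eps HP]; exists eps; intros y [Hy _]; apply HP, Hy.
  - exists (Im s).
    apply (filterlim_ext (fun n => Im (sum_n u n))).
    { intros n; rewrite sum_n_C; reflexivity. }
    apply filterlim_comp with (1 := Hs).
    intros P [eps HP]; exists eps; intros y [_ Hy]; apply HP, Hy.
Qed.

(** If the radius were some [x < 1], the midpoint of [x] and 1 would lie outside the disk of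
    convergence, where the terms cannot tend to 0. *)
Lemma CV_radius_ge_1 (u : nat -> R) :
  (forall r, 0 < r < 1 -> ex_series (fun n => u n * r ^ n)) -> Rbar_le 1 (CV_radius u).
Proof.
  intros H.
  apply Rbar_not_lt_le; intros Hlt.
  assert (H0 := CV_radius_ge_0 u).
  destruct (CV_radius u) as [x | |] eqn:E; simpl in *; try contradiction.
  assert (Hx : 0 < (1 + x) / 2 < 1) by lra.
  apply (CV_disk_outside u ((1 + x) / 2)).
  - rewrite E; simpl; rewrite Rabs_pos_eq; lra.
  - apply ex_series_lim_0, H, Hx.
Qed.

(** [D] is the Euler operator [x d/dx]: it multiplies the [n]-th coefficient by [n] and keeps the
    radius of convergence. Three applications give the cube, enough to dominate the falling
    factorials of derivatives up to order 3. *)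
Lemma ex_series_cube_weight (u : nat -> R) (r : R) :
  (forall s, 0 < s < 1 -> ex_series (fun n => u n * s ^ n)) -> 0 <= r < 1 ->
  ex_series (fun n => INR n ^ 3 * Rabs (u n) * r ^ n).
Proof.
  intros H Hr.
  set (D := fun v : nat -> R => PS_incr_1 (PS_derive v)).
  assert (HD : forall v n, D v n = INR n * v n).
  { intros v [| n]; [| reflexivity]; unfold D, PS_incr_1; simpl; rewrite Rmult_0_l;
      reflexivity. }
  assert (HR : CV_radius (D (D (D u))) = CV_radius u).
  { unfold D; do 3 rewrite CV_radius_incr_1, CV_radius_derive; reflexivity. }
  assert (Hdisk : CV_disk (D (D (D u))) r).
  { apply CV_disk_inside; rewrite HR.
    apply Rbar_lt_le_trans with 1; [| apply CV_radius_ge_1, H].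
    simpl; rewrite Rabs_pos_eq; lra. }
  revert Hdisk; apply ex_series_Rext; intros n.
  rewrite !HD, !Rabs_mult, (Rabs_pos_eq (INR n)), (Rabs_pos_eq (r ^ n));
    [ring | apply pow_le; lra | apply pos_INR].
Qed.

Lemma analytic_cube_weight (a : nat -> C) (r : R) :
  analytic_on_U a -> 0 <= r < 1 ->
  ex_series (fun n => INR n ^ 3 * Cmod (a n) * r ^ n).
Proof.
  intros Ha Hr.
  assert (Hc : forall s, 0 < s < 1 -> ex_series (fun n => Re (a n) * s ^ n) /\
                                      ex_series (fun n => Im (a n) * s ^ n)).
  { intros s Hs.
    destruct (ex_series_C_components (fun n => a n * RtoC s ^ n)%C) as [H1 H2].
    { apply Ha; rewrite Cmod_R, Rabs_pos_eq; lra. }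
    split; [revert H1 | revert H2]; apply ex_series_Rext; intros n;
      rewrite <- RtoC_pow; destruct (a n); simpl; ring. }
  assert (H1 := ex_series_cube_weight _ r (fun s Hs => proj1 (Hc s Hs)) Hr).
  assert (H2 := ex_series_cube_weight _ r (fun s Hs => proj2 (Hc s Hs)) Hr).
  apply ex_series_dom with (2 := ex_series_plus _ _ H1 H2).
  intros n; unfold plus; simpl.
  assert (0 <= INR n ^ 3) by apply pow_le, pos_INR.
  assert (0 <= r ^ n) by (apply pow_le; lra).
  change (INR n * (INR n * (INR n * 1))) with (INR n ^ 3).
  rewrite Rabs_pos_eq.
  - rewrite <- Rmult_plus_distr_r, <- Rmult_plus_distr_l.
    apply Rmult_le_compat_r; [assumption |].
    apply Rmult_le_compat_l; [assumption |].
    apply Cmod_le_re_im.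
  - apply Rmult_le_pos; [apply Rmult_le_pos |]; auto using Cmod_ge_0.
Qed.

(** * The third-order differential operator as a multiplier on power series coefficients *)

Definition Lop_coef (g d : R) (m : nat) : R :=
  g * INR (ffall m 1) + d * INR (ffall m 2) + (d - g) / 2 * INR (ffall m 3).

Lemma ffall_le_cube (m k : nat) : (1 <= k <= 3)%nat -> (ffall m k <= m * m * m)%nat.
Proof.
  intros Hk; assert (k = 1 \/ k = 2 \/ k = 3)%nat as [-> | [-> | ->]] by lia; simpl;
    destruct m as [| [| m]]; simpl; try lia; nia.
Qed.

Lemma pder_abs_summable (a : nat -> C) (k : nat) (z : C) :
  analytic_on_U a -> (1 <= k <= 3)%nat -> 0 < Cmod z < 1 ->
  abs_summable (fun m => RtoC (INR (ffall m k)) * a m * z ^ (m - k))%C.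
Proof.
  intros Ha Hk Hz.
  set (r := Cmod z) in *.
  assert (Hs := analytic_cube_weight a r Ha ltac:(lra)).
  assert (Hr3 : 0 < r ^ 3) by (apply pow_lt; lra).
  apply abs_summable_dom with (2 := ex_series_scal_l (/ r ^ 3) _ Hs).
  intros m; rewrite !Cmod_mult, Cmod_pow, Cmod_R, Rabs_pos_eq by apply pos_INR.
  fold r.
  (* As [k <= 3], the exponent [m - k + 3] is at least [m], also when the subtraction truncates to
     0. *)
  assert (Hp : r ^ (m - k) * r ^ 3 <= r ^ m).
  { rewrite <- pow_add.
    replace (m - k + 3)%nat with (m + (m - k + 3 - m))%nat by lia.
    rewrite pow_add.
    assert (0 < r ^ m) by (apply pow_lt; lra).
    assert (0 <= r ^ (m - k + 3 - m) <= 1).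
    { split; [apply pow_le; lra |].
      rewrite <- (pow1 (m - k + 3 - m)); apply pow_incr; lra. }
    nra. }
  assert (Hf : INR (ffall m k) <= INR m ^ 3).
  { replace (INR m ^ 3) with (INR (m * m * m)) by (rewrite !mult_INR; ring).
    apply le_INR, ffall_le_cube, Hk. }
  assert (Hp' : r ^ (m - k) <= / r ^ 3 * r ^ m).
  { apply Rmult_le_reg_r with (1 := Hr3); eapply Rle_trans; [exact Hp |].
    apply Req_le; field; lra. }
  assert (Hq : 0 <= r ^ (m - k)) by (apply pow_le; lra).
  assert (Hc := Cmod_ge_0 (a m)); assert (Hi := pos_INR (ffall m k)).
  apply Rle_trans with (INR m ^ 3 * Cmod (a m) * (/ r ^ 3 * r ^ m)).
  - apply Rmult_le_compat; try assumption.
    + apply Rmult_le_pos; assumption.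
    + apply Rmult_le_compat_r; assumption.
  - apply Req_le; unfold scal; simpl; unfold mult; simpl; ring.
Qed.

(** For [m <= 2] some exponents are truncated, but exactly there the falling factorial is 0. *)
Lemma Lop_term (g d : R) (c z : C) (m : nat) :
  (RtoC g * (RtoC (INR (ffall m 1)) * c * z ^ (m - 1))
   + RtoC d * z * (RtoC (INR (ffall m 2)) * c * z ^ (m - 2))
   + RtoC ((d - g) / 2) * z ^ 2 * (RtoC (INR (ffall m 3)) * c * z ^ (m - 3))
   = RtoC (Lop_coef g d m) * c * z ^ (m - 1))%C.
Proof.
  unfold Lop_coef; rewrite !RtoC_plus, !RtoC_mult.
  destruct m as [| [| [| m]]].
  - change (INR (ffall 0 1)) with 0; change (INR (ffall 0 2)) with 0;
      change (INR (ffall 0 3)) with 0; simpl; ring.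
  - change (INR (ffall 1 2)) with 0; change (INR (ffall 1 3)) with 0; simpl; ring.
  - change (INR (ffall 2 3)) with 0; simpl; ring.
  - replace (S (S (S m)) - 1)%nat with (S (S m)) by lia.
    replace (S (S (S m)) - 2)%nat with (S m) by lia.
    replace (S (S (S m)) - 3)%nat with m by lia.
    rewrite !Cpow_S; simpl (z ^ 2)%C; ring.
Qed.

Lemma Lop_series (g d : R) (a : nat -> C) (z : C) :
  analytic_on_U a -> 0 < Cmod z < 1 ->
  abs_summable (fun n => RtoC (Lop_coef g d (S n)) * a (S n) * z ^ n)%C /\
  Lop g d a z = csum (fun n => RtoC (Lop_coef g d (S n)) * a (S n) * z ^ n)%C.
Proof.
  intros Ha Hz.
  assert (S1 := pder_abs_summable a 1 z Ha ltac:(lia) Hz).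
  assert (S2 := pder_abs_summable a 2 z Ha ltac:(lia) Hz).
  assert (S3 := pder_abs_summable a 3 z Ha ltac:(lia) Hz).
  assert (T1 := abs_summable_scal (RtoC g) _ S1).
  assert (T2 := abs_summable_scal (RtoC d * z) _ S2).
  assert (T3 := abs_summable_scal (RtoC ((d - g) / 2) * z ^ 2) _ S3).
  assert (T12 := abs_summable_plus _ _ T1 T2).
  assert (T := abs_summable_plus _ _ T12 T3).
  assert (T' : abs_summable (fun m => RtoC (Lop_coef g d m) * a m * z ^ (m - 1))%C).
  { revert T; apply ex_series_Rext; intros m; f_equal; apply Lop_term. }
  assert (E : forall n, (RtoC (Lop_coef g d (S n)) * a (S n) * z ^ (S n - 1)
                         = RtoC (Lop_coef g d (S n)) * a (S n) * z ^ n)%C).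
  { intros n; replace (S n - 1)%nat with n by lia; reflexivity. }
  split.
  - apply abs_summable_incr_1 in T'; revert T'; apply ex_series_Rext; intros n.
    rewrite E; reflexivity.
  - unfold Lop, pder.
    rewrite <- (csum_scal _ _ S1), <- (csum_scal _ _ S2), <- (csum_scal _ _ S3),
      <- (csum_plus _ _ T1 T2), <- (csum_plus _ _ T12 T3).
    rewrite (csum_ext _ _ (fun m => Lop_term g d (a m) z m)).
    rewrite (csum_incr_1 _ T'), (csum_ext _ _ E).
    (* The index 0 term carries the truncated exponent 0, so the shift by one is legitimate only
       because its coefficient vanishes. *)
    replace (Lop_coef g d 0) with 0 by (unfold Lop_coef; simpl; ring).
    ring.
Qed.

(** * Coefficient bounds for the class *)

Lemma circ_pow (r x : R) (n : nat) :
  (circ r x ^ n = RtoC (r ^ n) * (cos (INR n * x), sin (INR n * x)))%C.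
Proof.
  induction n as [| n IH].
  - simpl; rewrite Rmult_0_l, cos_0, sin_0; apply C_eq; simpl; ring.
  - rewrite Cpow_S, IH, S_INR, Rmult_plus_distr_r, Rmult_1_l, cos_plus, sin_plus.
    apply C_eq; simpl; ring.
Qed.

Lemma exists_aligning_unit (z w : C) :
  exists e : C, Cmod e = 1 /\ Cmod (z + e * w)%C = Cmod z + Cmod w.
Proof.
  destruct (polar_form z) as [x Hx], (polar_form w) as [y Hy].
  exists (circ 1 (x - y)); split; [apply Cmod_circ; lra |].
  replace (z + circ 1 (x - y) * w)%C with (circ (Cmod z + Cmod w) x).
  - apply Cmod_circ; generalize (Cmod_ge_0 z) (Cmod_ge_0 w); lra.
  - rewrite Hx, Hy at 2; apply C_eq; unfold circ, Re, Im; simpl; set (u := x - y).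
    + replace (cos x) with (cos (u + y)) by (unfold u; f_equal; ring).
      rewrite cos_plus; ring.
    + replace (sin x) with (sin (u + y)) by (unfold u; f_equal; ring).
      rewrite sin_plus; ring.
Qed.

(** This is the limit [r -> 1] made explicit: with [r = 1 - h], Bernoulli's inequality gives
    [x r^k >= x (1 - k h)], and [h] is chosen so that the right side still exceeds [M] if
    [x > M]. *)
Lemma le_of_pow_mult_le (x M : R) (k : nat) :
  0 <= M -> (forall r, 0 < r < 1 -> x * r ^ k <= M) -> x <= M.
Proof.
  intros HM H; apply Rnot_lt_le; intros Hlt.
  assert (Hk := pos_INR k).
  set (h := (x - M) / (2 * x * (INR k + 1))).
  assert (Hx : 0 < 2 * x * (INR k + 1)) by nra.
  assert (Hh : 0 < h) by (apply Rdiv_lt_0_compat; lra).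
  assert (Hh2 : h * (2 * x * (INR k + 1)) = x - M) by (unfold h; field; nra).
  assert (Hh1 : h < 1) by nra.
  assert (Hb : 1 - INR k * h <= (1 - h) ^ k).
  { clearbody h; clear - Hh Hh1; induction k as [| k IH]; [simpl; lra |].
    rewrite S_INR; simpl.
    generalize (pos_INR k); intros Hk.
    apply Rle_trans with ((1 - h) * (1 - INR k * h)); [nra |].
    apply Rmult_le_compat_l; lra. }
  specialize (H (1 - h) ltac:(lra)).
  assert (Hx0 : 0 < x) by lra.
  assert (x * (1 - INR k * h) <= x * (1 - h) ^ k) by (apply Rmult_le_compat_l; lra).
  assert (0 < h * x) by (apply Rmult_lt_0_compat; assumption).
  nra.
Qed.

Lemma RH0_coeff_bound (g d l : R) (a b : nat -> C) (m : nat) :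
  l < g -> g <= d -> 0 < g -> in_RH0 g d l a b -> (2 <= m)%nat ->
  INR m * (Cmod (a m) + Cmod (b m)) <= 2 * (g - l) / (g + d).
Proof.
  intros Hl Hgd Hg [(Ha & Hb & _ & Ha1 & _ & Hb1) HRe] Hm.
  destruct (exists_aligning_unit (a m) (b m)) as (e & He & Hem).
  rewrite <- Hem.
  (* After division by [m] the multiplier is [g + d (m - 1)] plus a third-order term, nonnegative
     because [g <= d]; equality holds at [m = 2]. *)
  assert (HL : INR m * (g + d) <= Lop_coef g d m).
  { destruct m as [| [| n]]; [lia | lia |].
    unfold Lop_coef, ffall.
    replace (S (S n) - 1)%nat with (S n) by lia.
    replace (S n - 1)%nat with n by lia.
    rewrite !mult_INR, !S_INR; simpl INR.
    generalize (pos_INR n); intros Hn.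
    apply Rle_trans with ((INR n + 1 + 1)
      * (g + d * (INR n + 1) + (d - g) / 2 * ((INR n + 1) * INR n))).
    - apply Rmult_le_compat_l; [lra |].
      assert (0 <= (d - g) / 2 * ((INR n + 1) * INR n)) by (apply Rmult_le_pos; nra).
      nra.
    - apply Req_le; ring. }
  assert (Hbound : Lop_coef g d m * Cmod (a m + e * b m)%C <= 2 * (g - l)).
  { apply (le_of_pow_mult_le _ _ (m - 1)); [lra |].
    intros r Hr.
    (* Differentiation shifts the index, so the coefficient of index [m] sits at frequency [m - 1].
       The constant term is [g], since [a 1 = 1] and [b 1 = 0]. *)
    set (p := fun n => (RtoC (r ^ n) * (RtoC (Lop_coef g d (S n)) * (a (S n) + e * b (S n))))%C).
    assert (Hz : forall x, 0 < Cmod (circ r x) < 1) by (intros x; rewrite Cmod_circ; lra).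
    assert (Hterm : forall x n,
      (RtoC (Lop_coef g d (S n)) * a (S n) * circ r x ^ n
       + e * (RtoC (Lop_coef g d (S n)) * b (S n) * circ r x ^ n)
       = p n * (cos (INR n * x), sin (INR n * x)))%C).
    { intros x n; rewrite circ_pow; unfold p; ring. }
    assert (Hsum : forall x,
      abs_summable (fun n => p n * (cos (INR n * x), sin (INR n * x)))%C /\
      csum (fun n => p n * (cos (INR n * x), sin (INR n * x)))%C
      = (Lop g d a (circ r x) + e * Lop g d b (circ r x))%C).
    { intros x.
      destruct (Lop_series g d a (circ r x) Ha (Hz x)) as [Sa ->].
      destruct (Lop_series g d b (circ r x) Hb (Hz x)) as [Sb ->].
      assert (Sb' := abs_summable_scal e _ Sb).
      split.
      - assert (S' := abs_summable_plus _ _ Sa Sb').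
        revert S'; apply ex_series_Rext; intros n; f_equal; apply Hterm.
      - rewrite <- (csum_scal _ _ Sb), <- (csum_plus _ _ Sa Sb').
        symmetry; apply csum_ext, Hterm. }
    assert (Hp : abs_summable p).
    { destruct (Hsum 0) as [S0 _]; revert S0; apply ex_series_Rext; intros n; f_equal.
      rewrite Rmult_0_r, cos_0, sin_0; change (1, 0) with (RtoC 1); ring. }
    assert (Hcar := caratheodory_coeff p l (m - 1) Hp ltac:(lia)).
    replace (Re (p 0%nat)) with g in Hcar.
    - replace (Lop_coef g d m * Cmod (a m + e * b m)%C * r ^ (m - 1))
        with (Cmod (p (m - 1)%nat)).
      + apply Hcar; intros x; rewrite (proj2 (Hsum x)), re_plus.
        assert (Hx := HRe (circ r x) (proj2 (Hz x))).
        unfold Cminus in Hx; rewrite re_plus, re_opp, re_RtoC in Hx.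
        (* As [|e| = 1], the rotated co-analytic part has real part at least [- |Lop g d b|], which
           the class inequality absorbs. *)
        generalize (re_le_Cmod (e * Lop g d b (circ r x))%C).
        rewrite Cmod_mult, He; intros H; apply Rabs_le_between in H; lra.
      + unfold p; replace (S (m - 1)) with m by lia.
        rewrite !Cmod_mult, !Cmod_R, !Rabs_pos_eq; [ring | | apply pow_le; lra].
        apply Rle_trans with (2 := HL), Rmult_le_pos; [apply pos_INR | lra].
    - unfold p; rewrite Ha1, Hb1.
      replace (Lop_coef g d 1) with g by (unfold Lop_coef; simpl; ring).
      simpl; ring. }
  apply Rmult_le_reg_r with (g + d); [lra |].
  replace (2 * (g - l) / (g + d) * (g + d)) with (2 * (g - l)) by (field; lra).
  eapply Rle_trans with (2 := Hbound).
  generalize (Cmod_ge_0 (a m + e * b m)%C); nra.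
Qed.

(** * Distance of the harmonic map from the identity on a circle *)

Lemma pow_combination_dist_le (z1 z2 : C) (rho s t : R) (n : nat) :
  Cmod z1 = rho -> Cmod z2 = rho -> 0 <= s -> 0 <= t ->
  Cmod (RtoC t * z1 ^ S n - RtoC s * z2 ^ S n)%C
  <= INR (S n) * rho ^ n * Cmod (RtoC t * z1 - RtoC s * z2)%C.
Proof.
  intros H1 H2 Hs Ht.
  assert (Hrho : 0 <= rho) by (rewrite <- H1; apply Cmod_ge_0).
  set (d := Cmod (RtoC t * z1 - RtoC s * z2)%C).
  assert (Hd : 0 <= d) by apply Cmod_ge_0.
  (* |t z1 - s z2|^2 = (t - s)^2 rho^2 + t s |z1 - z2|^2 since |z1| = |z2| = rho. *)
  assert (Hmin : Rmin s t * Cmod (z1 - z2)%C <= d).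
  { assert (E1 := Cmod_sqr (z1 - z2)%C).
    assert (E2 := Cmod_sqr (RtoC t * z1 - RtoC s * z2)%C); fold d in E2.
    assert (F1 := Cmod_sqr z1); assert (F2 := Cmod_sqr z2).
    rewrite H1 in F1; rewrite H2 in F2.
    set (q := Cmod (z1 - z2)%C) in *.
    assert (Hq : 0 <= q) by apply Cmod_ge_0.
    assert (E : d * d = (t - s) * (t - s) * (rho * rho) + t * s * (q * q)).
    { rewrite E1, E2.
      replace ((t - s) * (t - s) * (rho * rho)) with
        (t * t * (rho * rho) + s * s * (rho * rho)
         - t * s * (rho * rho) - t * s * (rho * rho)) by ring.
      rewrite F1 at 1 3; rewrite F2; unfold Re, Im; simpl; ring. }
    assert (Hm : 0 <= Rmin s t) by (apply Rmin_glb; assumption).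
    assert (Hm1 := Rmin_l s t); assert (Hm2 := Rmin_r s t).
    set (mu := Rmin s t) in *.
    assert (mu * mu <= t * s) by nra.
    assert (0 <= (t - s) * (t - s) * (rho * rho))
      by (apply Rmult_le_pos; [apply Rle_0_sqr | nra]).
    assert (mu * q * (mu * q) <= d * d).
    { replace (mu * q * (mu * q)) with (mu * mu * (q * q)) by ring.
      assert (mu * mu * (q * q) <= t * s * (q * q))
        by (apply Rmult_le_compat_r; nra).
      lra. }
    assert (0 <= mu * q) by (apply Rmult_le_pos; assumption).
    nra. }
  induction n as [| n IH].
  - rewrite !Cpow_1_r; fold d; simpl; lra.
  - set (D := (RtoC t * z1 ^ S n - RtoC s * z2 ^ S n)%C) in *.
    assert (Hpow : 0 <= rho ^ S n) by (apply pow_le, Hrho).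
    enough (H : Cmod (RtoC t * z1 ^ S (S n) - RtoC s * z2 ^ S (S n))%C
                <= rho * Cmod D + rho ^ S n * (Rmin s t * Cmod (z1 - z2)%C)).
    { eapply Rle_trans; [exact H |].
      rewrite (S_INR (S n)).
      assert (rho * Cmod D <= rho * (INR (S n) * rho ^ n * d))
        by (apply Rmult_le_compat_l; assumption).
      assert (rho ^ S n * (Rmin s t * Cmod (z1 - z2)%C) <= rho ^ S n * d)
        by (apply Rmult_le_compat_l; assumption).
      replace ((INR (S n) + 1) * rho ^ S n * d)
        with (rho * (INR (S n) * rho ^ n * d) + rho ^ S n * d)
        by (rewrite <- tech_pow_Rmult; ring).
      lra. }
    (* The recursion can factor out [z1] or [z2]; the choice makes the remainder carry the smaller
       of the two weights, the one that [Hmin] controls. *)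
    destruct (Rle_lt_dec s t) as [Hst | Hst].
    + rewrite Rmin_left by exact Hst.
      replace (RtoC t * z1 ^ S (S n) - RtoC s * z2 ^ S (S n))%C
        with (z1 * D + z2 ^ S n * (RtoC s * (z1 - z2)))%C
        by (unfold D; rewrite !(Cpow_S _ (S n)); ring).
      eapply Rle_trans; [apply Cmod_triangle |].
      rewrite !Cmod_mult, Cmod_pow, Cmod_R, (Rabs_pos_eq s Hs), H1, H2; lra.
    + rewrite Rmin_right by lra.
      replace (RtoC t * z1 ^ S (S n) - RtoC s * z2 ^ S (S n))%C
        with (z2 * D + z1 ^ S n * (RtoC t * (z1 - z2)))%C
        by (unfold D; rewrite !(Cpow_S _ (S n)); ring).
      eapply Rle_trans; [apply Cmod_triangle |].
      rewrite !Cmod_mult, Cmod_pow, Cmod_R, (Rabs_pos_eq t Ht), H1, H2; lra.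
Qed.

(** The cubic weight is at least 1 from index 1 on; it is 0 at index 0, where [a 0 = 0] makes the
    comparison hold. *)
Lemma H0_abs_summable (a : nat -> C) (z : C) :
  analytic_on_U a -> a 0%nat = RtoC 0 -> Cmod z < 1 ->
  abs_summable (fun m => a m * z ^ m)%C.
Proof.
  intros Ha H0 Hz.
  assert (Hs := analytic_cube_weight a (Cmod z) Ha (conj (Cmod_ge_0 z) Hz)).
  apply abs_summable_dom with (2 := Hs); intros [| n].
  - rewrite H0, Cmod_mult, Cmod_0; simpl; lra.
  - rewrite Cmod_mult, Cmod_pow.
    apply Rmult_le_compat_r; [apply pow_le, Cmod_ge_0 |].
    rewrite <- (Rmult_1_l (Cmod (a (S n)))) at 1.
    apply Rmult_le_compat_r; [apply Cmod_ge_0 |].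
    apply pow_R1_Rle; rewrite S_INR; generalize (pos_INR n); lra.
Qed.

Lemma harm_csum (a b : nat -> C) (z : C) :
  analytic_on_U a -> analytic_on_U b -> a 0%nat = RtoC 0 -> b 0%nat = RtoC 0 ->
  Cmod z < 1 ->
  abs_summable (fun m => a m * z ^ m + Cconj (b m * z ^ m))%C /\
  harm a b z = csum (fun m => a m * z ^ m + Cconj (b m * z ^ m))%C.
Proof.
  intros Ha Hb Ha0 Hb0 Hz.
  assert (Sa := H0_abs_summable a z Ha Ha0 Hz).
  assert (Sb := abs_summable_conj _ (H0_abs_summable b z Hb Hb0 Hz)).
  split; [exact (abs_summable_plus _ _ Sa Sb) |].
  assert (E : forall c : nat -> C, pder c 0 z = csum (fun m => c m * z ^ m)%C).
  { intros c; apply csum_ext; intros m; rewrite Nat.sub_0_r; simpl; ring. }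
  rewrite (csum_plus _ _ Sa Sb), csum_conj; unfold harm; rewrite !E; reflexivity.
Qed.

(** Each term of index [m >= 2] is at most [B rho^(m-1)] times the distance on the right, and the
    geometric series from [m = 2] sums to [B rho / (1 - rho)]. *)
Lemma harm_near_identity (a b : nat -> C) (B rho s t th1 th2 : R) :
  in_H0 a b ->
  (forall m, (2 <= m)%nat -> INR m * (Cmod (a m) + Cmod (b m)) <= B) ->
  0 < rho < 1 -> 0 <= s -> 0 <= t ->
  Cmod ((RtoC t * harm a b (circ rho th1) - RtoC s * harm a b (circ rho th2))
        - (RtoC t * circ rho th1 - RtoC s * circ rho th2))%C
  <= B * rho / (1 - rho) * Cmod (RtoC t * circ rho th1 - RtoC s * circ rho th2)%C.
Proof.
  intros (Ha & Hb & Ha0 & Ha1 & Hb0 & Hb1) HB Hrho Hs Ht.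
  assert (C1 : Cmod (circ rho th1) = rho) by (apply Cmod_circ; lra).
  assert (C2 : Cmod (circ rho th2) = rho) by (apply Cmod_circ; lra).
  set (z1 := circ rho th1) in *; set (z2 := circ rho th2) in *.
  destruct (harm_csum a b z1 Ha Hb Ha0 Hb0 ltac:(lra)) as [S1 ->].
  destruct (harm_csum a b z2 Ha Hb Ha0 Hb0 ltac:(lra)) as [S2 ->].
  set (Dm := fun m => (RtoC t * z1 ^ m - RtoC s * z2 ^ m)%C).
  assert (T1 := abs_summable_scal (RtoC t) _ S1).
  assert (T2 := abs_summable_scal (RtoC (- s)) _ S2).
  assert (T := abs_summable_plus _ _ T1 T2).
  (* The weights [t] and [- s] are real, so they pass through the conjugation and both parts involve
     the same [Dm m]. *)
  assert (E : forall m,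
    (RtoC t * (a m * z1 ^ m + Cconj (b m * z1 ^ m))
     + RtoC (- s) * (a m * z2 ^ m + Cconj (b m * z2 ^ m))
     = a m * Dm m + Cconj (b m * Dm m))%C).
  { intros m; unfold Dm.
    generalize (z1 ^ m)%C (z2 ^ m)%C (a m) (b m); intros.
    apply C_eq; unfold Re, Im; simpl; ring. }
  assert (TD : abs_summable (fun m => a m * Dm m + Cconj (b m * Dm m))%C).
  { revert T; apply ex_series_Rext; intros m; f_equal; apply E. }
  replace (RtoC t * csum (fun m => a m * z1 ^ m + Cconj (b m * z1 ^ m))
           - RtoC s * csum (fun m => a m * z2 ^ m + Cconj (b m * z2 ^ m)))%C
    with (csum (fun m => a m * Dm m + Cconj (b m * Dm m)))%C.
  2:{ rewrite <- (csum_ext _ _ E), (csum_plus _ _ T1 T2), (csum_scal _ _ S1),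
        (csum_scal _ _ S2), RtoC_opp; ring. }
  (* The term of index 0 vanishes and that of index 1 is the identity part [Dm 1], which the
     subtraction cancels. *)
  rewrite (csum_incr_1 _ TD), (csum_incr_1 _ (abs_summable_incr_1 _ TD)).
  rewrite Ha0, Ha1, Hb0, Hb1.
  set (tail := csum _).
  replace (RtoC t * z1 - RtoC s * z2)%C with (Dm 1%nat)
    by (unfold Dm; rewrite !Cpow_1_r; reflexivity).
  replace (_ - Dm 1%nat)%C with tail.
  2:{ apply C_eq; unfold Re, Im; simpl; ring. }
  assert (Tt := abs_summable_incr_1 _ (abs_summable_incr_1 _ TD)).
  assert (Hg : is_series (fun n => rho ^ n) (/ (1 - rho)))
    by (apply is_series_geom; rewrite Rabs_pos_eq; lra).
  assert (Hg' : is_series (fun n => B * rho * Cmod (Dm 1%nat) * rho ^ n)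
                  (B * rho * Cmod (Dm 1%nat) * / (1 - rho)))
    by exact (is_series_scal_l (B * rho * Cmod (Dm 1%nat)) _ _ Hg).
  replace (B * rho / (1 - rho) * Cmod (Dm 1%nat))
    with (Series (fun n => B * rho * Cmod (Dm 1%nat) * rho ^ n)).
  2:{ rewrite (is_series_unique _ _ Hg'); field; lra. }
  eapply Rle_trans; [apply Cmod_csum_le, Tt |].
  apply Series_le; [| eexists; exact Hg'].
  intros n; split; [apply Cmod_ge_0 |].
  eapply Rle_trans; [apply Cmod_triangle |].
  rewrite Cmod_conj, !Cmod_mult, <- Rmult_plus_distr_r.
  assert (HD : Cmod (Dm (S (S n)))
               <= INR (S (S n)) * rho ^ S n * Cmod (Dm 1%nat)).
  { unfold Dm; rewrite !Cpow_1_r; apply pow_combination_dist_le; assumption. }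
  assert (Hab := HB (S (S n)) ltac:(lia)).
  assert (Hpos : 0 <= rho ^ S n * Cmod (Dm 1%nat)).
  { apply Rmult_le_pos; [apply pow_le; lra | apply Cmod_ge_0]. }
  assert (Hc : 0 <= Cmod (a (S (S n))) + Cmod (b (S (S n))))
    by (generalize (Cmod_ge_0 (a (S (S n)))) (Cmod_ge_0 (b (S (S n)))); lra).
  apply Rle_trans with (1 := Rmult_le_compat_l _ _ _ Hc HD).
  replace (_ * _) with (INR (S (S n)) * (Cmod (a (S (S n))) + Cmod (b (S (S n))))
                        * (rho ^ S n * Cmod (Dm 1%nat))) by ring.
  apply Rle_trans with (1 := Rmult_le_compat_r _ _ _ Hpos Hab).
  rewrite <- tech_pow_Rmult; apply Req_le; ring.
Qed.

(** * The root of the quadratic and the conclusion *)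

Lemma ps_root (g d l : R) :
  0 <= l -> l < g -> g <= d ->
  exists rs, 0 < rs < 1 /\ ps g d l rs = 0 /\
    forall r, r < 1 -> (r < rs -> 0 < ps g d l r) /\ (rs < r -> ps g d l r < 0).
Proof.
  intros Hl Hlg Hgd.
  set (K := d + 2 * g - l).
  assert (HK : 0 < K) by (unfold K; lra).
  (* Completing the square gives the root [1 - sqrt ((g - l) / K)] and the signs on both sides of
     it; it lies in [(0, 1)] because [K - (g - l) = d + g > 0]. *)
  assert (Hps : forall r, ps g d l r = K * ((1 - r) * (1 - r)) - (g - l))
    by (intros r; unfold ps, K; ring).
  set (v := sqrt ((g - l) / K)).
  assert (Hq : 0 < (g - l) / K) by (apply Rdiv_lt_0_compat; lra).
  assert (Hv : v * v = (g - l) / K) by (apply sqrt_sqrt; lra).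
  assert (Hv0 : 0 < v) by (apply sqrt_lt_R0, Hq).
  assert (HKv : K * (v * v) = g - l) by (rewrite Hv; field; lra).
  assert (Hv1 : v < 1).
  { apply Rnot_le_lt; intros Hv1.
    assert (K * 1 <= K * (v * v)) by (apply Rmult_le_compat_l; nra).
    unfold K in *; lra. }
  exists (1 - v); split; [lra | split].
  - rewrite Hps; replace (1 - (1 - v)) with v by ring; lra.
  - intros r Hr; rewrite Hps, <- HKv; split; intros H.
    + apply Rlt_0_minus, Rmult_lt_compat_l; [exact HK | nra].
    + apply Rlt_minus, Rmult_lt_compat_l; [exact HK | nra].
Qed.

Theorem theorem22 (g d l : R) (a b : nat -> Complex.C) :
  0 <= l -> l < g -> g <= d ->
  in_RH0 g d l a b ->
  exists rs : R,
    (0 < rs < 1 /\ ps g d l rs = 0) /\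
    (forall r, 0 < r < 1 -> ps g d l r = 0 -> r = rs) /\
    fully_starlike (harm a b) rs.
Proof.
  intros Hl Hlg Hgd Hf.
  destruct (ps_root g d l Hl Hlg Hgd) as (rs & Hrs & Hroot & Hsign).
  exists rs; split; [split; assumption | split].
  - intros r Hr Hr0; destruct (Hsign r (proj2 Hr)) as [H1 H2].
    destruct (Rtotal_order r rs) as [H | [H | H]]; [| exact H |].
    + generalize (H1 H); lra.
    + generalize (H2 H); lra.
  - intros rho Hrho.
    set (B := 2 * (g - l) / (g + d)).
    set (q := B * rho / (1 - rho)).
    assert (HBd : B * (g + d) = 2 * (g - l)) by (unfold B; field; lra).
    assert (HB : 0 < B) by (apply Rdiv_lt_0_compat; lra).
    assert (Hq : 0 <= q < 1).
    { split; [apply Rdiv_le_0_compat; nra |].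
      apply Rlt_div_l; [lra |].
      destruct (Hsign rho ltac:(lra)) as [Hpos _].
      specialize (Hpos (proj2 Hrho)); unfold ps in Hpos.
      apply Rmult_lt_reg_r with (g + d); [lra |].
      replace (B * rho * (g + d)) with (2 * (g - l) * rho) by (rewrite <- HBd; ring).
      apply Rmult_lt_reg_r with (1 - rho); [lra |].
      (* The two sides of the goal differ by exactly [ps g d l rho + (g - l) rho^2], and both
         summands are positive. *)
      assert (0 < (g - l) * (rho * rho)) by (apply Rmult_lt_0_compat; nra).
      nra. }
    assert (Hnear := fun s t th1 th2 =>
      harm_near_identity a b B rho s t th1 th2 (proj1 Hf)
        (fun m => RH0_coeff_bound g d l a b m Hlg Hgd ltac:(lra) Hf) ltac:(lra)).
    split.
    + intros th1 th2.
      apply (image_injective (harm a b) rho q (proj1 Hrho) Hq Hnear).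
    + exact (starlike_image (harm a b) rho q (proj1 Hrho) Hq Hnear).
Qed.
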